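(* In the abstract discrete setting of the context (discrete spaces and forms, stability assumptions with constants $\underline\alpha,\overline\alpha,\beta,\gamma$, and interpolates of the exact solution), let $(\boldsymbol{u}_{h\tau},p_{h\tau})\in\boldsymbol{\mathsf U}_h^{N+1}\times\mathsf P_h^{N+1}$ solve the abstract discrete problem (D1)--(D4), and define, for $0\le n\le N$, the errors $\boldsymbol{e}_h^n:=\boldsymbol{u}_h^n-\hat{\boldsymbol u}_h^n$ and $\epsilon_h^n:=p_h^n-\hat p_h^n$. Set $z_h^0:=0$ and $z_h^n:=\sum_{i=1}^n\tau\epsilon_h^i$ for $1\le n\le N$. Then $$\begin{aligned} &\underline{\alpha}\sum_{n=1}^N\tau\|\boldsymbol{e}_h^n\|_{\boldsymbol{\mathsf U},h}^2+\sum_{n=1}^N\tau\left(C_0\|\mathsf r_h\epsilon_h^n\|_{L^2(\Omega)}^2+\frac{\beta^2\underline\alpha}{2\overline\alpha^2}\|\mathsf r_h\epsilon_h^n-\pi_\Omega^0\mathsf r_h\epsilon_h^n\|_{L^2(\Omega)}^2\right)+\gamma\|z_h^N\|_{\mathsf P,h}^2\\ &\quad\le\mathcal C_1\sum_{n=1}^N\tau\|\mathcal E_{\boldsymbol{\mathsf U},h}^n\|_{\boldsymbol{\mathsf U},h,*}^2+\mathcal C_2\left(\sum_{n=1}^N\tau\|\mathcal E_{\mathsf P,h\tau}^n\|_{L^2(\Omega)}^2+t_{\rm F}\|\mathcal E_{0,h}\|_{L^2(\Omega)}^2\right)\\ &\qquad+\mathcal C_3\left(\sum_{n=1}^N\tau\|\pi_\Omega^0\mathcal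 E_{\mathsf P,h\tau}^n\|_{L^2(\Omega)}^2+t_{\rm F}\|\pi_\Omega^0\mathcal E_{0,h}\|_{L^2(\Omega)}^2\right), \end{aligned}$$ where $\mathcal C_1:=\frac{4\overline\alpha^2+2\underline\alpha^2}{\underline\alpha\,\overline\alpha^2}$, $\mathcal C_2:=\frac{16\overline\alpha^2}{\underline\alpha\beta^2}$, $\mathcal C_3:=\frac{4}{C_0}$ (with the convention that, if $C_0=0$, the whole term multiplied by $\mathcal C_3$ equals $0$), and the residuals $\mathcal E_{0,h}\in\mathsf L_h$, $\mathcal E_{\boldsymbol{\mathsf U},h}^n:\boldsymbol{\mathsf U}_h\to\mathbb{R}$ and $\mathcal E_{\mathsf P,h\tau}^n\in\mathsf L_h$ are such that $$(\mathcal E_{0,h},\mathsf r_hq_h)_{L^2(\Omega)}:=(\varphi^0,\mathsf r_hq_h)_{L^2(\Omega)}-C_0(\mathsf r_h\hat p_h^0,\mathsf r_hq_h)_{L^2(\Omega)}+\mathsf b_h(\hat{\boldsymbol u}_h^0,q_h)\qquad\forall q_h\in\mathsf P_h$$ and, for all $1\le n\le N$, $$\mathcal E_{\boldsymbol{\mathsf U},h}^n(\boldsymbol{v}_h):=\mathsf f_h^n(\boldsymbol{v}_h)-\mathsf a_h(\hat{\boldsymbol u}_h^n,\boldsymbol{v}_h)-\mathsf b_h(\boldsymbol{v}_h,\hat p_h^n)\qquad\forall\boldsymbol{v}_h\in\boldsymbol{\mathsf U}_h,$$ $$(\mathcal E_{\mathsf P,h\tau}^n,\mathsf r_hq_h)_{L^2(\Omega)}:=\sum_{i=1}^n\tau\Big[(\mathsf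 g^i+\boldsymbol\nabla\cdot(\boldsymbol K\boldsymbol\nabla\mathsf I^ip),\mathsf r_hq_h)_{L^2(\Omega)}-C_0(\mathsf r_h\delta_t^i\hat p_{h\tau},\mathsf r_hq_h)_{L^2(\Omega)}+\mathsf b_h(\delta_t^i\hat{\boldsymbol u}_{h\tau},q_h)\Big]\qquad\forall q_h\in\mathsf P_h.$$
   Context: $\Omega\subset\mathbb{R}^d$, $d\in\{2,3\}$, is a bounded connected polyhedral domain, $t_{\rm F}>0$, $C_0\ge0$, and $\boldsymbol K:\Omega\to\mathbb{R}^{d\times d}$ is a symmetric, bounded, uniformly elliptic tensor field. $\pi_\Omega^0\varphi:=|\Omega|^{-1}\int_\Omega\varphi$ (identified with a constant function). **Discrete spaces and forms.** $N\ge1$ is an integer, $\tau:=t_{\rm F}/N$, $t^n:=n\tau$; for a family $\varphi_\tau=(\varphi^n)_{0\le n\le N}$ in a vector space, $\delta_t^n\varphi_\tau:=(\varphi^n-\varphi^{n-1})/\tau$ for $1\le n\le N$. $\boldsymbol{\mathsf U}_h$ and $\mathsf P_h$ are finite-dimensional real vector spaces; $\mathsf r_h:\mathsf P_h\to L^2(\Omega)$ is linear with range $\mathsf L_h$. $\mathsf a_h:\boldsymbol{\mathsf U}_h\times\boldsymbol{\mathsf U}_h\to\mathbb{R}$, $\mathsf b_h:\boldsymbol{\mathsf U}_h\times\mathsf P_h\to\mathbb{R}$, $\mathsf c_h:\mathsf P_h\times\mathsf P_h\to\mathbb{R}$ are bilinear forms; $\mathsf c_h$ is symmetric; there is a bilinear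 form $\widetilde{\mathsf b}_h:\boldsymbol{\mathsf U}_h\times\mathsf L_h\to\mathbb{R}$ with $\mathsf b_h(\boldsymbol{v}_h,q_h)=\widetilde{\mathsf b}_h(\boldsymbol{v}_h,\mathsf r_hq_h)$ for all $(\boldsymbol{v}_h,q_h)$. The data are linear forms $\mathsf f_h^n:\boldsymbol{\mathsf U}_h\to\mathbb{R}$ and functions $\mathsf g^n\in L^2(\Omega)$, $1\le n\le N$, and $\varphi^0\in L^2(\Omega)$; if $C_0=0$, $\int_\Omega\varphi^0=0$ and $\int_\Omega\mathsf g^n=0$ for all $1\le n\le N$. **Stability.** $\boldsymbol{\mathsf U}_h$ carries a norm $\|\cdot\|_{\boldsymbol{\mathsf U},h}$ and $\mathsf P_h$ a seminorm $\|\cdot\|_{\mathsf P,h}$ that is a norm on $\{q_h\in\mathsf P_h:\int_\Omega\mathsf r_hq_h=0\}$. For a linear form $\ell_h$ on $\boldsymbol{\mathsf U}_h$, $\|\ell_h\|_{\boldsymbol{\mathsf U},h,*}:=\sup_{\boldsymbol{v}_h\ne\boldsymbol 0}\ell_h(\boldsymbol{v}_h)/\|\boldsymbol{v}_h\|_{\boldsymbol{\mathsf U},h}$. There are reals $0<\underline\alpha\le\overline\alpha$, $\gamma>0$, $\beta>0$ such that, for all $\boldsymbol{v}_h,\boldsymbol{w}_h\in\boldsymbol{\mathsf U}_h$ and $q_h\in\mathsf P_h$: $\underline\alpha\|\boldsymbol{v}_h\|_{\boldsymbol{\mathsf U},h}^2\le\mathsf a_h(\boldsymbol{v}_h,\boldsymbol{v}_h)$;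 $\mathsf a_h(\boldsymbol{w}_h,\boldsymbol{v}_h)\le\overline\alpha\|\boldsymbol{w}_h\|_{\boldsymbol{\mathsf U},h}\|\boldsymbol{v}_h\|_{\boldsymbol{\mathsf U},h}$; $\gamma\|q_h\|_{\mathsf P,h}^2\le\mathsf c_h(q_h,q_h)$; $\beta\|\mathsf r_hq_h-\pi_\Omega^0\mathsf r_hq_h\|_{L^2(\Omega)}\le\|\mathsf b_h(\cdot,q_h)\|_{\boldsymbol{\mathsf U},h,*}$. **Abstract discrete problem.** For $n=1,\dots,N$: (D1) $\mathsf a_h(\boldsymbol{u}_h^n,\boldsymbol{v}_h)+\mathsf b_h(\boldsymbol{v}_h,p_h^n)=\mathsf f_h^n(\boldsymbol{v}_h)$ for all $\boldsymbol{v}_h\in\boldsymbol{\mathsf U}_h$; (D2) $C_0(\mathsf r_h\delta_t^np_{h\tau},\mathsf r_hq_h)_{L^2(\Omega)}-\mathsf b_h(\delta_t^n\boldsymbol{u}_{h\tau},q_h)+\mathsf c_h(p_h^n,q_h)=(\mathsf g^n,\mathsf r_hq_h)_{L^2(\Omega)}$ for all $q_h\in\mathsf P_h$; (D3) $C_0(\mathsf r_hp_h^0,\mathsf r_hq_h)_{L^2(\Omega)}-\mathsf b_h(\boldsymbol{u}_h^0,q_h)=(\varphi^0,\mathsf r_hq_h)_{L^2(\Omega)}$ for all $q_h\in\mathsf P_h$; (D4) if $C_0=0$, $\int_\Omega\mathsf r_hp_h^n=0$ for all $1\le n\le N$. **Exact pore pressure.** $p$ is the pore pressure component of the solution of the Biot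 problem $-\boldsymbol\nabla\cdot\boldsymbol\sigma(\boldsymbol\nabla_{\rm s}\boldsymbol u)+\boldsymbol\nabla p=\boldsymbol f$, $\partial_t(C_0p+\boldsymbol\nabla\cdot\boldsymbol u)-\boldsymbol\nabla\cdot(\boldsymbol K\boldsymbol\nabla p)=g$ in $\Omega\times(0,t_{\rm F})$ ($\boldsymbol\sigma$ a linear stress--strain law), with $\boldsymbol u=\boldsymbol 0$ and $\boldsymbol K\boldsymbol\nabla p\cdot\boldsymbol n=0$ on $\partial\Omega$, and $C_0p(0)+\boldsymbol\nabla\cdot\boldsymbol u(0)=\phi^0$; if $C_0=0$, $\int_\Omega p(t)=0$ for all $t$. The regularity $p\in C^0([0,t_{\rm F}];H^1(\Omega))$ and $\boldsymbol\nabla\cdot(\boldsymbol K\boldsymbol\nabla p)\in L^2(0,t_{\rm F};L^2(\Omega))$ is what gives meaning to the interpolates below. **Interpolates.** $\hat{\boldsymbol u}_{h\tau}=(\hat{\boldsymbol u}_h^n)_{0\le n\le N}\in\boldsymbol{\mathsf U}_h^{N+1}$ is a given family (meant to encode information on the exact displacement at times $t^n$). $\mathfrak p_h\in L^2(0,t_{\rm F};\mathsf P_h)$ satisfies, for a.e. $t\in(0,t_{\rm F})$, $\mathsf c_h(\mathfrak p_h(t),q_h)=-(\boldsymbol\nabla\cdot(\boldsymbol K\boldsymbol\nabla p(\cdot,t)),\mathsf r_hq_h)_{L^2(\Omega)}$ for all $q_h\in\mathsf P_h$ and $\int_\Omega\mathsf r_h\mathfrak p_h(t)=\int_\Omega p(t)$.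 For each $1\le n\le N$, a linear time interpolator $\mathsf I^n:L^2(t^{n-1},t^n;V)\to V$ is given, with $V$ a generic vector space. Set $\hat p_h^n:=\mathsf I^n\mathfrak p_h$ for $1\le n\le N$; $\hat p_h^0\in\mathsf P_h$ is such that $(\mathsf r_h\hat p_h^0,q_h)_{L^2(\Omega)}=(p(0),q_h)_{L^2(\Omega)}$ for all $q_h\in\mathsf L_h$; $\hat p_{h\tau}:=(\hat p_h^n)_{0\le n\le N}$. *)

(* Defs.v *)
From HB Require Import structures.
From mathcomp Require Import all_boot all_order all_algebra.
From mathcomp Require Import all_classical all_reals all_analysis.
Set Implicit Arguments.
Unset Strict Implicit.
Unset Printing Implicit Defensive.
Import Order.TTheory GRing.Theory Num.Theory numFieldNormedType.Exports.
Local Open Scope classical_set_scope.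
Local Open Scope ring_scope.

(* Row vectors carry the sigma-algebra generated by the coordinates, i.e. the
   Borel sets (see open_rV_measurable). *)
Definition rV_display : measure_display.
Proof. exact: default_measure_display. Qed.

Section rV_measurable.
Variables (R : realType) (n : nat).

Let coords : 'I_n -> 'rV[R]_n -> measurableTypeR R := fun i x => x ord0 i.

Let rV_set0 : g_sigma_preimage coords set0.
Proof. exact: sigma_algebra0. Qed.

Let rV_setC A : g_sigma_preimage coords A -> g_sigma_preimage coords (~` A).
Proof. exact: sigma_algebraC. Qed.

Let rV_bigcup (F : (set 'rV[R]_n)^nat) :
  (forall i, g_sigma_preimage coords (F i)) ->
  g_sigma_preimage coords (\bigcup_i (F i)).
Proof. exact: sigma_algebra_bigcup. Qed.

HB.instance Definition _ := @isMeasurable.Build rV_display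
  'rV[R]_n (g_sigma_preimage coords) rV_set0 rV_setC rV_bigcup.

Lemma measurable_coord (i : 'I_n) :
  measurable_fun setT (fun x : 'rV[R]_n => x ord0 i : measurableTypeR R).
Proof.
move=> _ Y mY; rewrite setTI; apply: sub_sigma_algebra => /=.
rewrite -bigcup_seq/=; exists i => /=; first by rewrite mem_index_enum.
by exists Y => //; rewrite setTI.
Qed.

Lemma measurable_fun_rV d (T : measurableType d) (f : T -> 'rV[R]_n) :
  (forall i, measurable_fun setT (fun x => f x ord0 i : measurableTypeR R)) ->
  measurable_fun setT f.
Proof.
move=> mf; apply: measurability => //= _ [C + <-].
rewrite -bigcup_seq => -[i _ [B mB <-]].
by rewrite !setTI; have := mf i measurableT B mB; rewrite setTI.
Qed.

End rV_measurable.

Section rV_lebesgue.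
Variable R : realType.

Definition rV_cons n (x : measurableTypeR R * 'rV[R]_n) : 'rV[R]_n.+1 :=
  \row_i (if unlift ord0 i is Some j then x.2 ord0 j else x.1).

Definition rV_uncons n (x : 'rV[R]_n.+1) : measurableTypeR R * 'rV[R]_n :=
  (x ord0 ord0, \row_j x ord0 (lift ord0 j)).

Lemma rV_consK n : cancel (@rV_cons n) (@rV_uncons n).
Proof.
move=> [a x]; rewrite /rV_uncons /rV_cons mxE unlift_none; congr pair.
by apply/rowP => j; rewrite !mxE liftK.
Qed.

Lemma measurable_rV_cons n : measurable_fun setT (@rV_cons n).
Proof.
apply: measurable_fun_rV => i; rewrite /rV_cons.
under eq_fun do rewrite mxE.
case: unliftP => [j _|_]; last exact: measurable_fst.
apply: (measurableT_comp (measurable_coord j)); exact: measurable_snd.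
Qed.

Lemma measurable_rV_uncons n : measurable_fun setT (@rV_uncons n).
Proof.
apply/measurable_fun_pairP; split; first exact: (measurable_coord ord0).
apply: measurable_fun_rV => i /=.
under eq_fun do rewrite mxE.
exact: measurable_coord.
Qed.

Section step.
Variables (n : nat) (m : {sigma_finite_measure set 'rV[R]_n -> \bar R}).

Definition rV_lebesgue_step : set 'rV[R]_n.+1 -> \bar R :=
  pushforward (product_measure1 (@lebesgue_measure R) m) (@rV_cons n).

Let mcons := @isMeasurableFun.Build _ _ _ _ _ (@measurable_rV_cons n).
HB.instance Definition _ := mcons.

Let step0 : rV_lebesgue_step set0 = 0%E.
Proof. exact: measure0. Qed.

Let step_ge0 A : (0 <= rV_lebesgue_step A)%E.
Proof. exact: measure_ge0. Qed.

Let step_sigma_additive : semi_sigma_additive rV_lebesgue_step.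
Proof. exact: measure_semi_sigma_additive. Qed.

HB.instance Definition _ := isMeasure.Build _ _ _ rV_lebesgue_step
  step0 step_ge0 step_sigma_additive.

Let step_sigma_finite : sigma_finite setT rV_lebesgue_step.
Proof.
have /sigma_finiteP[F [TF ndF Foo]] := sigma_finiteT (@lebesgue_measure R).
have /sigma_finiteP[G [TG ndG Goo]] := sigma_finiteT m.
exists (fun k => @rV_uncons n @^-1` (F k `*` G k)).
  apply/esym/seteqP; split=> // x _.
  have [k _ Fk] : (\bigcup_k F k) (rV_uncons x).1 by rewrite -TF.
  have [l _ Gl] : (\bigcup_k G k) (rV_uncons x).2 by rewrite -TG.
  exists (maxn k l) => //; split.
  - by move: Fk; exact/subsetPset/ndF/leq_maxl.
  - by move: Gl; exact/subsetPset/ndG/leq_maxr.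
move=> k; have [mF Fk] := Foo k; have [mG Gk] := Goo k; split.
  rewrite -[X in measurable X]setTI.
  by apply: measurable_rV_uncons => //; exact: measurableX.
rewrite /rV_lebesgue_step /pushforward -comp_preimage.
rewrite (_ : _ \o _ = idfun); last by rewrite funeqE => x; exact: rV_consK.
by rewrite preimage_id product_measure1E// lte_mul_pinfty// ge0_fin_numE.
Qed.

HB.instance Definition _ := Measure_isSigmaFinite.Build _ _ _ rV_lebesgue_step
  step_sigma_finite.
End step.

(* Lebesgue measure on R^n, as an iterated product of the one on R; see
   rV_lebesgue_box for its values. *)
Fixpoint rV_lebesgue n : {sigma_finite_measure set 'rV[R]_n -> \bar R} :=
  match n with
  | 0 => @dirac _ _ (0 : 'rV[R]_0) R
  | k.+1 => rV_lebesgue_step (rV_lebesgue k)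
  end.

Lemma rV_lebesgue_box n (A : 'I_n -> set (measurableTypeR R)) :
  (forall i, measurable (A i)) ->
  rV_lebesgue n [set x : 'rV[R]_n | forall i, A i (x ord0 i)] =
  (\prod_(i < n) lebesgue_measure (A i))%E.
Proof.
elim: n A => [|n IH] A mA.
  by rewrite big_ord0 /= diracE mem_set// => -[].
rewrite big_ord_recl -IH// /= /rV_lebesgue_step /pushforward.
rewrite -product_measure1E//; last first.
  rewrite [X in measurable X](_ : _ =
      \bigcap_(i in [set: 'I_n]) ((fun x : 'rV[R]_n => x ord0 i) @^-1`
        A (lift ord0 i))); last first.
    by apply/seteqP; split=> x /= h i; [move=> _; exact: h|exact: h].
  apply: fin_bigcap_measurable; first exact: finite_finset.
  move=> i _; rewrite -[X in measurable X]setTI.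
  exact: (measurable_coord i).
congr (product_measure1 _ _ _); apply/seteqP; split=> -[a x] /=.
  move=> h; split; first by have := h ord0; rewrite mxE unlift_none.
  by move=> i; have := h (lift ord0 i); rewrite mxE liftK.
move=> [h0 h] i; rewrite mxE.
by case: unliftP => [j ->|->].
Qed.

Lemma open_rV_measurable n (U : set 'rV[R]_n) : open U -> measurable U.
Proof.
move=> oU.
pose V (p : 'rV[rat]_n * nat) : set 'rV[R]_n :=
  ball (map_mx ratr p.1 : 'rV[R]_n) (p.2.+1%:R^-1 : R).
rewrite (_ : U = \bigcup_(p in [set: 'rV[rat]_n * nat])
    (if `[< V p `<=` U >] then V p else set0)); last first.
  apply/seteqP; split=> [x Ux|x [p _]]; last first.
    by case: asboolP => // VU /VU.
  have /nbhs_ballP[e /= e0 xeU] : nbhs x U by exact: open_nbhs_nbhs.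
  pose k := Num.truncn (e / 2)^-1.
  have ke : k.+1%:R^-1 < e / 2 :> R.
    by rewrite invf_plt ?posrE ?divr_gt0// truncnS_gt// invr_ge0 divr_ge0// ltW.
  have k0 : 0 < k.+1%:R^-1 :> R by rewrite invr_gt0.
  have /choice[q qx] i : exists q : rat,
      x ord0 i - k.+1%:R^-1 < ratr q < x ord0 i + k.+1%:R^-1.
    have /rat_in_itvoo[q] : x ord0 i - k.+1%:R^-1 < x ord0 i + k.+1%:R^-1.
      by rewrite ltrD2l gtrN.
    by rewrite in_itv/=; exists q.
  have xV : ball x (k.+1%:R^-1 : R) (map_mx ratr (\row_i q i) : 'rV[R]_n).
    split=> // i j; rewrite !mxE ord1 /ball/= ltr_distlC.
    by have /andP[? ?] := qx j; apply/andP.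
  exists (\row_i q i, k) => //; rewrite ifT; first exact: ball_sym.
  apply/asboolP => y Vy; apply: xeU.
  have := ball_triangle xV Vy; apply: le_ball.
  by rewrite [e]splitr lerD// ltW.
apply: countable_bigcupT_measurable; first exact: countableP.
move=> p; case: ifP => // _.
rewrite (_ : V p = \bigcap_(i in [set: 'I_n])
    ((fun x : 'rV[R]_n => x ord0 i) @^-1`
      ball (ratr (p.1 ord0 i) : R) (p.2.+1%:R^-1 : R))); last first.
  apply/seteqP; split=> [x [_ Vx] i _|x Vx].
    by have := Vx ord0 i; rewrite mxE.
  split=> [|i j]; first by rewrite invr_gt0.
  by rewrite mxE ord1; exact: (Vx j I).
apply: fin_bigcap_measurable; first exact: finite_finset.
move=> i _; rewrite -[X in measurable X]setTI.
by rewrite ball_itv; apply: (measurable_coord i).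
Qed.

End rV_lebesgue.

Section domain.
Variables (R : realType) (d : nat).
Implicit Types Om : set 'rV[R]_d.

Definition halfspace (h : 'rV[R]_d * R) : set 'rV[R]_d :=
  [set x | \sum_i h.1 ord0 i * x ord0 i <= h.2].

Definition polyhedron (s : seq ('rV[R]_d * R)) : set 'rV[R]_d :=
  [set x | forall h, h \in s -> halfspace h x].

(* Polyhedral domains are the bounded connected interiors of finite unions of
   convex polyhedra; this rules out slits but not reentrant corners. *)
Definition polyhedral_domain Om : Prop :=
  [/\ Om !=set0, bounded_set Om, connected Om &
      exists P : seq (seq ('rV[R]_d * R)),
        Om = interior [set x | exists2 s, s \in P & polyhedron s x]].

Lemma polyhedral_domain_measurable Om : polyhedral_domain Om -> measurable Om.
Proof.
by move=> [_ _ _ [P ->]]; apply: open_rV_measurable; exact: open_interior.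
Qed.

Definition vol Om (hOm : polyhedral_domain Om) :
    {measure set 'rV[R]_d -> \bar R} :=
  mrestr (rV_lebesgue R d) (polyhedral_domain_measurable hOm).

Definition partial (i : 'I_d) (f : 'rV[R]_d -> R) (x : 'rV[R]_d) : R :=
  'D_(delta_mx ord0 i) f x.

Definition iter_partial (s : seq 'I_d) (f : 'rV[R]_d -> R) : 'rV[R]_d -> R :=
  foldr partial f s.

Definition smooth (f : 'rV[R]_d -> R) : Prop :=
  forall s : seq 'I_d, continuous (iter_partial s f) /\
    forall i x, derivable (iter_partial s f) x (delta_mx ord0 i).

Definition test_function Om (psi : 'rV[R]_d -> R) : Prop :=
  smooth psi /\
  exists C, [/\ compact C, C `<=` Om & forall x, ~ C x -> psi x = 0].

End domain.

(* L^2(Omega): its elements are functions, so equality in L^2 is equality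
   almost everywhere. *)
Notation L2 hOm := (LfunType (vol hOm) (lee1n 2)).

(* H^1 functions are stored together with their weak gradient, which they
   determine almost everywhere. *)
Notation H1car d hOm := (L2 hOm * {ffun 'I_d -> L2 hOm})%type.

Section lebesgue_sobolev.
Variables (R : realType) (d : nat) (Om : set 'rV[R]_d).
Variable hOm : polyhedral_domain Om.
Local Notation mu := (vol hOm).
Implicit Types f g : 'rV[R]_d -> R.

Definition intO f : R := (\int[mu]_x f x)%R.
Definition ip f g : R := intO (fun x => f x * g x).
Definition L2norm f : R := fine ('N[mu]_2%:E[EFin \o f])%E.
Definition mean f : R := (fine (mu setT))^-1 * intO f.

Definition weak_grad f (G : 'I_d -> 'rV[R]_d -> R) : Prop :=
  forall i psi, test_function Om psi ->
    ip f (partial i psi) = - ip (G i) psi.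

Definition weak_div (F : 'I_d -> 'rV[R]_d -> R) f : Prop :=
  forall psi, test_function Om psi ->
    intO (fun x => \sum_i F i x * partial i psi x) = - ip f psi.

Definition H1 : set (H1car d hOm) :=
  [set q : H1car d hOm | weak_grad q.1 (fun i => q.2 i)].

Definition H1norm (q : H1car d hOm) : R :=
  Num.sqrt (L2norm q.1 ^+ 2 + \sum_i L2norm (q.2 i) ^+ 2).

(* H^1_0 is the H^1-closure of the test functions. *)
Definition H10 : set (H1car d hOm) :=
  [set q : H1car d hOm | H1 q /\ forall e : R, 0 < e -> exists psi, test_function Om psi /\
     L2norm (fun x => q.1 x - psi x) ^+ 2
     + \sum_i L2norm (fun x => q.2 i x - partial i psi x) ^+ 2 < e].

Definition tensor_field (K : 'rV[R]_d -> 'M[R]_d) : Prop :=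
  [/\ forall i j, measurable_fun Om (fun x => K x i j),
      forall x, Om x -> (K x)^T = K x,
      exists M, forall x i j, Om x -> `|K x i j| <= M &
      exists2 k : R, 0 < k & forall x (xi : 'cV[R]_d), Om x ->
        k * \sum_i xi i ord0 ^+ 2 <= (xi^T *m K x *m xi) ord0 ord0].

Definition tensor_app (K : 'rV[R]_d -> 'M[R]_d) (G : 'I_d -> 'rV[R]_d -> R) :
    'I_d -> 'rV[R]_d -> R :=
  fun i x => \sum_j K x i j * G j x.

(* The domain of q |-> div (K grad q) in L^2, stored as its graph: the triple
   ((q, grad q), div (K grad q)). *)
Definition divKgrad_graph (K : 'rV[R]_d -> 'M[R]_d) :
    set (H1car d hOm * L2 hOm) :=
  [set q : H1car d hOm * L2 hOm | H1 q.1 /\ weak_div (tensor_app K (fun i => q.1.2 i)) q.2].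

End lebesgue_sobolev.
Arguments H1 {R d Om} hOm.
Arguments H10 {R d Om} hOm.
Arguments divKgrad_graph {R d Om} hOm K.

(* A value space for functions of time: the subspace ts_mem of a vector space
   with a seminorm ts_norm, two elements being identified when the seminorm of
   their difference is 0. Working with a seminorm lets L^2(Omega) and H^1(Omega)
   be represented by functions instead of classes of functions. *)
Record tspace (R : realType) := TSpace {
  ts_car :> lmodType R ;
  ts_mem : set ts_car ;
  ts_norm : ts_car -> R }.
Arguments ts_mem {R} t.
Arguments ts_norm {R} t.

Section time.
Variable R : realType.
Implicit Types V W : tspace R.
Local Notation leb := (@lebesgue_measure R).

Definition ae_on (a b : R) (P : R -> Prop) : Prop :=
  {ae leb, forall t : measurableTypeR R, a < (t : R) < b -> P t}.

Definition simple_curve V (s : R -> V) : Prop :=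
  exists n (A : 'I_n -> set (measurableTypeR R)) (v : 'I_n -> V),
    (forall i, measurable (A i)) /\
    (forall t, s t = \sum_i (\1_(A i) t : R) *: v i).

(* The Bochner space L^2(a, b; V): a.e. limits of simple functions, with square
   integrable norm. *)
Definition L2t (a b : R) V (phi : R -> V) : Prop :=
  [/\ ae_on a b (fun t => ts_mem V (phi t)),
      exists2 s : nat -> R -> V, forall k, simple_curve (s k) &
        ae_on a b (fun t => (fun k => ts_norm V (s k t - phi t)) @ \oo --> (0 : R)) &
      (\int[leb]_(t in `]a, b[) ((ts_norm V (phi t) ^+ 2)%:E) < +oo)%E].

Definition bounded_linear V W (T : {linear V -> W}) : Prop :=
  (forall x, ts_mem V x -> ts_mem W (T x)) /\
  exists C, forall x, ts_mem V x -> ts_norm W (T x) <= C * ts_norm V x.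

(* A linear map L^2(a, b; V) -> V given for a generic V, that is, for every V in
   the class CV of value spaces, and natural in V: it commutes with the bounded
   linear maps between spaces of CV. It need not preserve constants. The other
   clauses say that it is V-valued and well defined and linear on L^2. *)
Definition time_interpolator (CV : tspace R -> Prop) (a b : R)
    (I : forall V, (R -> V) -> V) : Prop :=
  [/\ forall V phi, CV V -> L2t a b phi -> ts_mem V (I V phi),
      forall V c phi psi, CV V -> L2t a b phi -> L2t a b psi ->
        ts_norm V (I V (fun t => c *: phi t + psi t)
                   - (c *: I V phi + I V psi)) = 0,
      forall V phi psi, CV V -> L2t a b phi -> L2t a b psi ->
        ae_on a b (fun t => ts_norm V (phi t - psi t) = 0) ->
        ts_norm V (I V phi - I V psi) = 0 &
      forall V W (T : {linear V -> W}) phi, CV V -> CV W ->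
        bounded_linear T -> L2t a b phi ->
        ts_norm W (T (I V phi) - I W (fun t => T (phi t))) = 0].

End time.

Section spaces.
Variables (R : realType) (d : nat) (Om : set 'rV[R]_d).
Variable hOm : polyhedral_domain Om.

Definition R_space : tspace R :=
  @TSpace R R^o setT (fun x => `|x|).

(* A finite-dimensional space carries a single norm up to equivalence; this is
   the l^1 norm of the coordinates. *)
Definition fin_space (V : vectType R) : tspace R :=
  @TSpace R V setT (fun v => \sum_i `|coord (vbasis fullv) i v|).

Definition L2_space : tspace R :=
  @TSpace R (L2 hOm) setT (fun f => L2norm hOm f).

Definition H1_space : tspace R :=
  @TSpace R (H1car d hOm) (H1 hOm) (@H1norm R d Om hOm).

Definition H10_space : tspace R :=
  @TSpace R (H1car d hOm) (H10 hOm) (@H1norm R d Om hOm).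

Definition divKgrad_space (K : 'rV[R]_d -> 'M[R]_d) : tspace R :=
  @TSpace R (H1car d hOm * L2 hOm)%type (divKgrad_graph hOm K)
    (fun q => Num.sqrt (H1norm q.1 ^+ 2 + L2norm hOm q.2 ^+ 2)).

End spaces.

Section biot.
Variables (R : realType) (d : nat) (Om : set 'rV[R]_d).
Variable hOm : polyhedral_domain Om.

Definition strain (v : 'I_d -> H1car d hOm) (x : 'rV[R]_d) : 'M[R]_d :=
  \matrix_(i, j) (((v i).2 j x + (v j).2 i x) / 2).

Definition divergence (v : 'I_d -> H1car d hOm) (x : 'rV[R]_d) : R :=
  \sum_i (v i).2 i x.

(* Weak form. The clamped condition is u(t) in H^1_0; the no-flux condition comes
   from testing the mass balance with all of H^1, and the initial condition from
   the time test functions theta, which vanish at tF but not at 0. *)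
Definition biot_weak_solution (tF C0 : R) (K : 'rV[R]_d -> 'M[R]_d)
    (sigma : 'M[R]_d -> 'M[R]_d) (f : R -> 'I_d -> L2 hOm) (g : R -> L2 hOm)
    (phi0 : L2 hOm) (u : R -> 'I_d -> H1car d hOm) (p : R -> H1car d hOm) :
    Prop :=
  [/\ [/\ forall i, L2t 0 tF (V := L2_space hOm) (fun t => f t i),
          L2t 0 tF (V := L2_space hOm) g,
          forall i, L2t 0 tF (V := H10_space hOm) (fun t => u t i) &
          L2t 0 tF (V := H1_space hOm) p],
      forall v : 'I_d -> H1car d hOm, (forall i, H10 hOm (v i)) ->
        ae_on 0 tF (fun t =>
          intO hOm (fun x => \sum_i \sum_j
            sigma (strain (u t) x) i j * strain v x i j)
          - ip hOm (p t).1 (divergence v) = \sum_i ip hOm (f t i) (v i).1),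
      forall (q : H1car d hOm) (theta : R -> R), H1 hOm q ->
        (forall t, derivable theta t 1) -> continuous (derive1 theta) ->
        theta tF = 0 ->
        - (\int[lebesgue_measure]_(t in `]0%R, tF[)
             (ip hOm (fun x => C0 * (p t).1 x + divergence (u t) x) q.1
              * derive1 theta t))
        + (\int[lebesgue_measure]_(t in `]0%R, tF[)
             (intO hOm (fun x => \sum_i
                tensor_app K (fun j => (p t).2 j) i x * q.2 i x) * theta t))
        = theta 0 * ip hOm phi0 q.1
          + (\int[lebesgue_measure]_(t in `]0%R, tF[)
               (ip hOm (g t) q.1 * theta t)) &
      C0 = 0 -> forall t, 0 <= t <= tF -> intO hOm (p t).1 = 0].

Definition C0_H1 (tF : R) (p : R -> H1car d hOm) : Prop :=
  forall t, 0 <= t <= tF -> H1 hOm (p t) /\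
    forall e : R, 0 < e -> exists2 del : R, 0 < del &
      forall s, 0 <= s <= tF -> `|s - t| < del -> H1norm (p s - p t) < e.

End biot.

Section discrete.
Variable R : realType.

Definition is_seminorm (V : lmodType R) (N : V -> R) : Prop :=
  [/\ forall v, 0 <= N v, forall v w, N (v + w) <= N v + N w &
      forall a v, N (a *: v) = `|a| * N v].

Definition is_norm (V : lmodType R) (N : V -> R) : Prop :=
  is_seminorm N /\ forall v, N v = 0 -> v = 0.

(* When V is trivial the supremum of the empty set is 0. *)
Definition dual_norm (V : lmodType R) (N : V -> R) (l : V -> R) : R :=
  sup [set l v / N v | v in [set v | v != 0]].

Definition delta_t (V : lmodType R) (tau : R) (phi : nat -> V) (n : nat) : V :=
  tau^-1 *: (phi n - phi n.-1).

Variables (d : nat) (Om : set 'rV[R]_d) (hOm : polyhedral_domain Om).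
Variables (U P : vectType R) (r : P -> L2 hOm).

Definition linear_ae : Prop :=
  forall a q q', (r (a *: q + q') : 'rV[R]_d -> R)
    = (a *: r q + r q' : L2 hOm) %[ae vol hOm].

(* The range of r in L^2(Omega). *)
Definition Lh (f : L2 hOm) : Prop :=
  exists q, (f : 'rV[R]_d -> R) = r q %[ae vol hOm].

Definition factors_through (b : U -> P -> R) : Prop :=
  exists bt : U -> L2 hOm -> R,
  [/\ forall v f f', Lh f -> Lh f' ->
        (f : 'rV[R]_d -> R) = f' %[ae vol hOm] -> bt v f = bt v f',
      forall f, Lh f -> scalar (bt^~ f),
      forall v a f f', Lh f -> Lh f' ->
        bt v (a *: f + f') = a * bt v f + bt v f' &
      forall v q, b v q = bt v (r q)].

End discrete.

(* Main.v *)
(* Summing (D2) over the time steps gives, with (D1), the error equations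
     a(e^n, v) + b(v, ep^n) = EU^n(v),
     C0 (r ep^n, r q) - b(e^n, q) + c(z^n, q) = (E0 + EP^n, r q);
   the exact flux enters only through c(phat^n, q) = - (div (K grad (I^n p)), r q),
   which is naturality of I^n. Testing with v = e^n and q = ep^n cancels b, and
   tau c(z^n, ep^n) = c(z^n, z^n - z^(n-1)) telescopes up to a nonnegative
   remainder since c is symmetric and nonnegative. The inf-sup condition turns
   half of the coercivity of a into control of r ep^n minus its mean, and Young's
   inequality absorbs the right-hand side, whose mean part pairs only with the
   mean of r ep^n: that is 0 if C0 = 0 and controlled by C0 |r ep^n|^2
   otherwise. *)
Require Import Defs.
From HB Require Import structures.
From mathcomp Require Import all_boot all_order all_algebra.
From mathcomp Require Import all_classical all_reals all_analysis.
From mathcomp Require Import measurable_realfun.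
From mathcomp Require Import ring lra.
Set Implicit Arguments.
Unset Strict Implicit.
Unset Printing Implicit Defensive.
Import Order.TTheory GRing.Theory Num.Theory numFieldNormedType.Exports.
Local Open Scope classical_set_scope.
Local Open Scope ring_scope.

(** * The inner product of L^2 *)

Section square_integrable.
Context (R : realType) (d : nat) (Om : set 'rV[R]_d) (hOm : polyhedral_domain Om).
Local Notation mu := (vol hOm).
Local Notation sqint := (Lfun mu 2%:E).
Implicit Types f g h : 'rV[R]_d -> R.

Lemma sqint_lin (a : R) f g : f \in sqint -> g \in sqint ->
  (fun x => a * f x + g x) \in sqint.
Proof.
move=> hf hg.
have [_ H] := Lfun_submod_closed mu (lee1n 2).
exact: (H a f g).
Qed.

Lemma ipC f g : ip hOm f g = ip hOm g f.
Proof. by rewrite /ip; congr intO; apply/funext => x; rewrite mulrC. Qed.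

Lemma sqint_ip f g : f \in sqint -> g \in sqint ->
  mu.-integrable setT (EFin \o (fun x => f x * g x)).
Proof. by move=> hf hg; apply/Lfun1_integrable; exact: Lfun2_mul_Lfun1. Qed.

Lemma ip_linl (a : R) f g h : f \in sqint -> g \in sqint -> h \in sqint ->
  ip hOm (fun x => a * f x + g x) h = a * ip hOm f h + ip hOm g h.
Proof.
move=> hf hg hh; rewrite /ip /intO.
rewrite (_ : (fun x => (a * f x + g x) * h x) =
   (fun x => (a * (f x * h x)) + g x * h x)); last first.
  by apply/funext => x; ring.
rewrite RintegralD ?RintegralZl//; try exact: sqint_ip.
exact: (integrableZl measurableT a (sqint_ip hf hh)).
Qed.

Lemma L2_linE (a : R) (f g : L2 hOm) :
  (a *: f + g : L2 hOm) = (fun x => a * f x + g x) :> ('rV[R]_d -> R).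
Proof. by []. Qed.

Lemma ip_sqr_lin (a : R) f g : f \in sqint -> g \in sqint ->
  ip hOm (fun x => a * f x + g x) (fun x => a * f x + g x) =
  a ^+ 2 * ip hOm f f + 2 * a * ip hOm f g + ip hOm g g.
Proof.
move=> hf hg; have hc := sqint_lin a hf hg.
by rewrite ip_linl// (ipC f) (ipC g) !ip_linl// (ipC g f); ring.
Qed.

(** Both sides are [fine] of the integral of f^2. If that integral is infinite, [fine] gives 0 on
    both sides, so the identity holds for every [f]. *)
Lemma L2norm_sqr f : L2norm hOm f ^+ 2 = ip hOm f f.
Proof.
rewrite /L2norm /ip /intO /Rintegral unlock /Lnorm.
under eq_integral => x _ do rewrite /= powR_mulrn// -normrX ger0_norm ?sqr_ge0// expr2.
rewrite fine_poweR -powR_mulrn ?powR_ge0// -powRrM mulVf// powRr1//.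
by rewrite fine_ge0// integral_ge0// => x _; rewrite lee_fin -expr2 sqr_ge0.
Qed.

Lemma vol_fin : (mu setT < +oo)%E.
Proof.
have [_ [M [_ hM]] _ _] := hOm.
(* [bounded_set] provides a bound only by numbers strictly above [M], hence [M + 1]. The domain then
   lies in a cube, whose volume is a finite product of finite lengths. *)
have {}hM : forall x, Om x -> forall i, `|x ord0 i| <= M + 1.
  move=> x Ox i.
  have : `|x| <= M + 1 by apply: hM => //; rewrite ltrDl.
  apply: le_trans; rewrite [leRHS]mx_normrE.
  exact: (le_bigmax _ (fun ij : 'I_1 * 'I_d => `|x ij.1 ij.2|) (ord0, i)).
pose A (i : 'I_d) : set (measurableTypeR R) := `[- (M + 1), M + 1]%classic.
have mA i : measurable (A i) by exact: measurable_itv.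
have mB : measurable [set x : 'rV[R]_d | forall i, A i (x ord0 i)].
  rewrite [X in measurable X](_ : _ =
      \bigcap_(i in [set: 'I_d]) ((fun x : 'rV[R]_d => x ord0 i) @^-1` A i)); last first.
    by apply/seteqP; split=> x /= h i; [move=> _; exact: h|exact: h].
  apply: fin_bigcap_measurable; first exact: finite_finset.
  by move=> i _; rewrite -[X in measurable X]setTI; exact: (measurable_coord i).
apply: (@le_lt_trans _ _ (rV_lebesgue R d [set x | forall i, A i (x ord0 i)])).
  rewrite [leLHS](_ : _ = rV_lebesgue R d Om); last first.
    by rewrite /vol /mrestr/= /mrestr setTI.
  apply: le_measure; rewrite ?inE//; first exact: polyhedral_domain_measurable.
  by move=> x Ox i; rewrite /A/= in_itv/= -ler_norml; exact: hM.
rewrite rV_lebesgue_box//.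
rewrite ltey_eq prode_fin_num// => i _.
by rewrite lebesgue_measure_itv/=; case: ifP.
Qed.

Lemma sqint_cst (a : R) : cst a \in sqint.
Proof.
rewrite inE/=; apply/andP; split; rewrite inE//=.
rewrite /finite_norm unlock poweR_lty//=.
by rewrite integral_cst// lte_mul_pinfty// ?lee_fin ?powR_ge0 ?vol_fin.
Qed.

Lemma intO_ip f : intO hOm f = ip hOm f (cst 1).
Proof. by rewrite /ip; congr intO; apply/funext => x; rewrite mulr1. Qed.

Lemma ip_cst (a : R) f : f \in sqint -> ip hOm (cst a) f = a * intO hOm f.
Proof.
move=> hf.
rewrite /ip /intO RintegralZl//; apply: eq_integrable (sqint_ip hf (sqint_cst 1)) => //.
by move=> x _; rewrite /= mulr1.
Qed.

Lemma intO_mean f : f \in sqint -> intO hOm f = mean hOm f * fine (mu setT).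
Proof.
move=> hf; rewrite /mean.
(* A zero volume would give the inverse in [mean] its default value 0; the integral over a null set
   is then 0 as well. *)
have [m0|m0] := eqVneq (fine (mu setT)) 0; last by field.
rewrite m0 mulr0 /intO /Rintegral null_set_integral//=.
  by apply/measurable_EFinP; move: hf; rewrite inE => /andP[/[!inE]].
by rewrite -[LHS]fineK ?m0// ge0_fin_numE// vol_fin.
Qed.

Lemma ip_ge0 f : 0 <= ip hOm f f.
Proof. by rewrite -L2norm_sqr sqr_ge0. Qed.

Lemma ip_aeql f g h : f \in sqint -> g \in sqint -> h \in sqint ->
  f = g %[ae mu] -> ip hOm f h = ip hOm g h.
Proof.
move=> hf hg hh fg; rewrite /ip /intO /Rintegral; congr fine.
apply: ae_eq_integral => //.
- exact: measurable_int (sqint_ip hf hh).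
- exact: measurable_int (sqint_ip hg hh).
- by apply: filterS fg => x /= -> .
Qed.
End square_integrable.

(** * Young inequalities and the splitting off of mean values in L^2 *)

Section estimates.
Context (R : realType) (d : nat) (Om : set 'rV[R]_d) (hOm : polyhedral_domain Om).
Local Notation mu := (vol hOm).
Local Notation sqint := (Lfun mu 2%:E).
Implicit Types f g h : 'rV[R]_d -> R.

(** Expand k |g - (2/k) f|^2 >= 0. *)
Lemma ip_young (k : R) f g : 0 < k -> f \in sqint -> g \in sqint ->
  4 * ip hOm f g <= k * L2norm hOm g ^+ 2 + 4 / k * L2norm hOm f ^+ 2.
Proof.
move=> k0 hf hg; rewrite !L2norm_sqr.
set c := - 2 / k.
have hc := sqint_lin c hf hg.
have := ip_ge0 hOm (fun x => c * f x + g x).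
rewrite ip_sqr_lin// -(pmulr_rge0 _ k0).
rewrite [leRHS](_ : _ = k * ip hOm g g + 4 / k * ip hOm f f - 4 * ip hOm f g) ?subr_ge0//.
by rewrite /c; field; rewrite gt_eqF.
Qed.

Lemma ip_mean f g : f \in sqint -> g \in sqint ->
  ip hOm f (cst (mean hOm g)) = ip hOm (cst (mean hOm f)) g.
Proof. by move=> hf hg; rewrite ipC !ip_cst// !intO_mean//; ring. Qed.

(** By the parallelogram law the gap is |g - f|^2. The factor [1] gives the sum the shape of
    [sqint_lin]. *)
Lemma L2norm_add_sqr f g : f \in sqint -> g \in sqint ->
  L2norm hOm (fun x => 1 * f x + g x) ^+ 2
  <= 2 * (L2norm hOm f ^+ 2 + L2norm hOm g ^+ 2).
Proof.
move=> hf hg.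
have := ip_ge0 hOm (fun x => -1 * f x + g x).
by rewrite !L2norm_sqr !ip_sqr_lin//; lra.
Qed.

(** Split g into its mean and the rest. Young's inequality absorbs the pairing with the rest, where
    8 is 4 times the 2 of [L2norm_add_sqr]. The mean is moved onto f and f' by [ip_mean] and left
    alone, since its treatment depends on whether [C0] vanishes. *)
Lemma residual_young (k : R) f f' g : 0 < k ->
  f \in sqint -> f' \in sqint -> g \in sqint ->
  4 * (ip hOm f g + ip hOm f' g) <=
    k * L2norm hOm (fun x => g x - mean hOm g) ^+ 2
    + 8 / k * (L2norm hOm f ^+ 2 + L2norm hOm f' ^+ 2)
    + 4 * (ip hOm (cst (mean hOm f)) g + ip hOm (cst (mean hOm f')) g).
Proof.
move=> k0 hf hf' hg; set m := mean hOm g.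
have hF := sqint_lin 1 hf hf'.
have hm := sqint_cst hOm m.
have hw : (fun x => g x - m) \in sqint.
  rewrite (_ : (fun x => g x - m) = (fun x => -1 * cst m x + g x)).
    exact: sqint_lin.
  by apply/funext => x; rewrite mulN1r addrC.
have ipg h : h \in sqint ->
    ip hOm h g = ip hOm h (fun x => g x - m) + ip hOm (cst (mean hOm h)) g.
  move=> hh; rewrite -ip_mean// -/m [LHS]ipC.
  rewrite (_ : g = (fun x => 1 * (g x - m) + cst m x)); last first.
    by apply/funext => x; rewrite mul1r subrK.
  rewrite ip_linl// mul1r (ipC _ h) (ipC _ h (cst m)).
  by congr (ip hOm _ _ + _); apply/funext => x; rewrite mul1r addrK.
rewrite (ipg f)// (ipg f')//.
have := ip_young k0 hF hw; rewrite ip_linl// mul1r.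
have h8 : 4 / k * L2norm hOm (fun x => 1 * f x + f' x) ^+ 2 <=
    8 / k * (L2norm hOm f ^+ 2 + L2norm hOm f' ^+ 2).
  rewrite (_ : 8 / k * _ = 4 / k * (2 * (L2norm hOm f ^+ 2 + L2norm hOm f' ^+ 2))).
    by rewrite ler_pM2l ?divr_gt0// L2norm_add_sqr.
  by field; rewrite gt_eqF.
lra.
Qed.

End estimates.

(** * Dual norms *)

Section dual_norm.
Context (R : realType) (U : vectType R).

(* With coercive continuous a, this bounds every linear form on U without norm
   equivalence; the supremum in dual_norm would have the junk value 0 if it were
   taken over an unbounded set. *)
Lemma riesz_coercive (a : {bilinear U -> U -> R | *%R & *%R}) (l : U -> R) :
  scalar l ->
  (forall v, a v v = 0 -> v = 0) -> exists w, forall v, a w v = l v.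
Proof.
move=> ll a0.
pose L : {linear U -> R^o} :=
  HB.pack (l : U -> R^o) (GRing.isLinear.Build R U R^o *:%R l ll).
have l0 : l 0 = 0 by exact: (linear0 L).
have lZ k x : l (k *: x) = k * l x by rewrite -[k *: x]addr0 ll l0 addr0.
pose n : nat := \dim (fullv : {vspace U}).
pose e : n.-tuple U := vbasis fullv.
have ecoord v : v = \sum_(i < n) coord e i v *: e`_i.
  by apply: coord_vbasis; rewrite memvf.
have al w v : a w v = \sum_(i < n) coord e i v * a w e`_i.
  rewrite {1}(ecoord v) linear_sum/=; apply: eq_bigr => i _.
  by rewrite linearZ.
(* The coefficients a(w, e_i) are packed into an endomorphism, so that injectivity gives
   surjectivity. It is injective because F w = F v forces a(w - v, .) = 0, which is then tested with
   w - v. *)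
pose F (w : U) : U := \sum_(i < n) a w e`_i *: e`_i.
have Flin : linear F.
  move=> k x y; rewrite /F scaler_sumr -big_split; apply: eq_bigr => i _ /=.
  by rewrite linearPl scalerDl scalerA.
pose T : {linear U -> U} := HB.pack F (GRing.isLinear.Build R U U *:%R F Flin).
have TE w v : F w = F v -> forall i : 'I_n, a w e`_i = a v e`_i.
  have fe : free e by apply: (basis_free (vbasisP _)).
  move=> FE i; have := congr1 (coord e i) FE.
  by rewrite /F !coord_sum_free.
have kerT : lker (linfun T) == 0%VS.
  apply/lker0P => w v; rewrite !lfunE/= => /TE wv; apply/eqP.
  rewrite -subr_eq0; apply/eqP/a0; rewrite linearBl/= al [X in _ - X]al.
  by under eq_bigr do rewrite wv; rewrite subrr.
have : \sum_(i < n) l e`_i *: e`_i \in limg (linfun T) by rewrite lker0_limgf ?memvf.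
move=> /memv_imgP[w _]; rewrite lfunE/= => wE.
have fe : free e by apply: (basis_free (vbasisP _)).
exists w => v; rewrite al -[RHS]/(L v) [in RHS](ecoord v) linear_sum/=.
apply: eq_bigr => i _.
have := congr1 (coord e i) wE; rewrite /F !coord_sum_free// => <-.
by rewrite lZ.
Qed.

Lemma is_norm_gt0 (N : U -> R) v : is_norm N -> v != 0 -> 0 < N v.
Proof.
move=> [[N0 _ _] N1] v0; rewrite lt_neqAle N0 andbT eq_sym.
by apply: contra v0 => /eqP/N1 ->.
Qed.

Lemma dual_norm_ub (N : U -> R) (l : U -> R) (C : R) : is_norm N ->
  l 0 = 0 ->
  (forall v, l v <= C * N v) -> forall v, l v <= dual_norm N l * N v.
Proof.
move=> hN l0 lC v; have [->|v0] := eqVneq v 0.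
  have [[_ _ NZ] _] := hN.
  by have := NZ 0 0; rewrite l0 scale0r normr0 mul0r => ->; rewrite mulr0.
rewrite -ler_pdivrMr ?is_norm_gt0//; apply: ub_le_sup; last by exists v.
exists C => _ [w /= w0 <-].
by rewrite ler_pdivrMr ?is_norm_gt0.
Qed.

(** The sign of [C] serves the trivial space, where the supremum is that of the empty set, 0. *)
Lemma dual_norm_le (N : U -> R) (l : U -> R) (C : R) : is_norm N -> 0 <= C ->
  (forall v, l v <= C * N v) -> dual_norm N l <= C.
Proof.
move=> hN C0 lC; rewrite /dual_norm.
have [->|/set0P ne0] := eqVneq [set l v / N v | v in [set v | v != 0]] set0.
  by rewrite sup0.
apply: ge_sup => // _ [w /= w0 <-].
by rewrite ler_pdivrMr ?is_norm_gt0.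
Qed.

(** Adding the bounds at v and at -v cancels l and leaves 0 <= 2 |l| N(v), with |l| the dual
    norm. *)
Lemma dual_norm_ge0 (N : U -> R) (l : U -> R) (C : R) : is_norm N ->
  (forall v, l (- v) = - l v) ->
  (forall v, l v <= C * N v) -> 0 <= dual_norm N l.
Proof.
move=> hN lN lC.
have [[v v0]|h] := pselect (exists v : U, v != 0); last first.
  rewrite /dual_norm (_ : [set _ | _ in _] = set0) ?sup0//.
  by rewrite -subset0 => x [v v0 _]; apply: h; exists v.
have l0 : l 0 = 0 by have := lN 0; rewrite oppr0; lra.
have [[N0 _ NZ] _] := hN.
have h1 := dual_norm_ub hN l0 lC v.
have h2 := dual_norm_ub hN l0 lC (- v).
rewrite -scaleN1r NZ normrN1 mul1r scaleN1r lN in h2.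
rewrite -(pmulr_lge0 _ (is_norm_gt0 hN v0)); lra.
Qed.

End dual_norm.

(** * Bochner spaces and time interpolators *)

Section lower_integral.
Context d (T : measurableType d) (R : realType) (mu : {measure set T -> \bar R}).
Local Open Scope ereal_scope.

Import HBNNSimple.

(* The integral of a nonnegative function is a supremum over the simple functions
   below it, so that it is monotone without any measurability. It is not additive
   on nonmeasurable functions; integral_affine_lty is what is left of this. *)
Lemma ge0_le_integral_restrict (D E : set T) (f g : T -> \bar R) :
  (forall x, D x -> 0 <= f x) -> (forall x, E x -> 0 <= g x) ->
  (forall x, (f \_ D) x <= (g \_ E) x) ->
  \int[mu]_(x in D) f x <= \int[mu]_(x in E) g x.
Proof.
move=> f0 g0 fg; rewrite !ge0_integralE//; apply: ge_ereal_sup => _ [h/= hf <-].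
by apply: ereal_sup_ubound; exists h => //= x; exact: le_trans (fg x).
Qed.

Lemma integral_affine_lty (D : set T) (f g : T -> R) (C M : R) :
  measurable D -> mu D < +oo -> (0 < C)%R -> (0 <= M)%R ->
  (forall x, D x -> 0 <= f x)%R -> (forall x, D x -> 0 <= g x)%R ->
  (forall x, D x -> f x <= C * g x + M)%R ->
  \int[mu]_(x in D) (g x)%:E < +oo -> \int[mu]_(x in D) (f x)%:E < +oo.
Proof.
move=> mD muD C0 M0 f0 g0 fg goo.
apply: (@le_lt_trans _ _ (C%:E * \int[mu]_(x in D) (g x)%:E + M%:E * mu D)); last first.
  by rewrite lte_add_pinfty// lte_mul_pinfty// ?lee_fin// ltW.
rewrite [leLHS]ge0_integralE//; apply: ge_ereal_sup => _ [h/= hf <-].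
(* The affine bound solved for g, with the simple function [h] in place of f: [h'] is measurable and
   lies below g on [D]. Additivity is thus used for [h'] only, and g enters through monotonicity. *)
pose h' x : R := (Num.max (h x - M) 0 / C)%R.
have h'0 x : (0 <= h' x)%R by rewrite divr_ge0 ?le_max ?lexx ?orbT// ltW.
have mh : measurable_fun D h by exact: measurable_funTS.
have mh' : measurable_fun D h'.
  apply: measurable_funM => //; apply: measurable_maxr => //.
  exact: measurable_funB.
have hD x : ~ D x -> h x = 0%R.
  move=> nDx; apply/eqP; rewrite eq_le fun_ge0 andbT -lee_fin.
  by have := hf x; rewrite patchN// notin_setE.
rewrite -integralT_nnsfun.
rewrite (_ : \int[mu]_x (h x)%:E = \int[mu]_(x in D) (h x)%:E); last first.
  rewrite [RHS]integral_mkcond; apply: eq_integral => x _; rewrite patchE.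
  by case: ifPn => //; rewrite notin_setE => nDx; rewrite hD.
apply: (@le_trans _ _ (\int[mu]_(x in D) (C%:E * (h' x)%:E + M%:E))).
  apply: ge0_le_integral => //.
  - by move=> x _; rewrite lee_fin fun_ge0.
  - exact/measurable_EFinP.
  - apply/measurable_EFinP => /=; apply: measurable_funD => //.
    exact: measurable_funM.
  - move=> x _; rewrite lee_fin /h' mulrCA divff ?gt_eqF// mulr1.
    by rewrite -lerBlDr le_max lexx.
rewrite ge0_integralD//; first last.
- apply/measurable_EFinP => /=; exact: measurable_funM.
- by move=> x _; rewrite lee_fin mulr_ge0// ltW.
rewrite integral_cst//; apply: leeD2r.
rewrite ge0_integralZl_EFin//; last 3 first.
- by move=> x _; rewrite lee_fin.
- exact/measurable_EFinP.
- exact: ltW.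
apply: lee_wpmul2l; first by rewrite lee_fin ltW.
apply: ge0_le_integral_restrict => [x _|x Dx|x]; rewrite ?lee_fin ?g0//.
rewrite !patchE; case: ifPn => [/set_mem Dx|]; last by []; rewrite lee_fin.
rewrite ler_pdivrMr// ge_max mulr_ge0 ?g0 ?(ltW C0)// andbT lerBlDr.
have := hf x; rewrite patchT ?mem_set// lee_fin => /le_trans; apply.
by rewrite mulrC fg.
Qed.
End lower_integral.

Section bochner.
Context (R : realType).
Implicit Types V W : tspace R.

Lemma ae_on_sub (a b a' b' : R) (P Q : R -> Prop) : a <= a' -> b' <= b ->
  (forall t, a < t < b -> P t -> Q t) -> ae_on a b P -> ae_on a' b' Q.
Proof.
move=> aa bb PQ; have F := ae_filter_ringOfSetsType (@lebesgue_measure R).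
refine (filterS (F := almost_everywhere (@lebesgue_measure R)) _) => t h.
move=> /andP[at' tb].
have tab : a < (t : R) < b by rewrite (le_lt_trans aa at') (lt_le_trans tb bb).
by apply: PQ => //; exact: h.
Qed.

Lemma ae_onW (a b : R) (P : R -> Prop) :
  (forall t, a < t < b -> P t) -> ae_on a b P.
Proof.
move=> h; have F := ae_filter_ringOfSetsType (@lebesgue_measure R).
refine (filterS (F := almost_everywhere (@lebesgue_measure R)) _ filterT) => t _.
exact: h.
Qed.

Lemma ae_onI (a b : R) (P Q : R -> Prop) :
  ae_on a b P -> ae_on a b Q -> ae_on a b (fun t => P t /\ Q t).
Proof.
have F := ae_filter_ringOfSetsType (@lebesgue_measure R).
refine (@filterS2 _ _ F _ _ _ _) => t hP hQ tab.
by split; [exact: hP|exact: hQ].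
Qed.

Lemma L2t_sub (a b a' b' : R) V (phi : R -> V) : a <= a' -> b' <= b ->
  L2t a b phi -> L2t a' b' phi.
Proof.
move=> aa bb [hm [s ss sphi] hi]; split.
- exact: (ae_on_sub aa bb _ hm).
- by exists s => //; exact: (ae_on_sub aa bb _ sphi).
- apply: le_lt_trans hi; apply: ge0_le_integral_restrict => [x _|x _|x].
  + by rewrite lee_fin sqr_ge0.
  + by rewrite lee_fin sqr_ge0.
  + rewrite !patchE; case: ifPn => [/set_mem/= xab|_]; last first.
      by case: ifP => //; rewrite lee_fin sqr_ge0.
    rewrite ifT// mem_set//=; move: xab; rewrite !in_itv/= => /andP[at' tb].
    by rewrite (le_lt_trans aa at') (lt_le_trans tb bb).
Qed.

Lemma itv_oo_lty (a b : R) : (@lebesgue_measure R `]a, b[ < +oo)%E.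
Proof. by rewrite lebesgue_measure_itv/=; case: ifP => _; rewrite ltry. Qed.

Lemma L2t_linear (a b : R) V W (T : {linear V -> W}) (C : R) (phi : R -> V) :
  (forall x, ts_mem W x) -> (forall x, 0 <= ts_norm W x) ->
  (forall x, ts_norm W (T x) <= C * ts_norm V x) ->
  L2t a b phi -> L2t a b (fun t => T (phi t)).
Proof.
move=> hW W0 TC [hm [s ss sphi] hi]; split.
- exact: ae_onW.
- exists (fun k t => T (s k t)).
    move=> k; have [n [A [v [mA sE]]]] := ss k.
    exists n, A, (fun i => T (v i)); split => // t.
    by rewrite sE linear_sum/=; apply: eq_bigr => i _; rewrite linearZ.
  apply: (ae_on_sub (lexx _) (lexx _) _ sphi) => t _ st.
  have st' : C * ts_norm V (s k t - phi t) @[k --> \oo] --> 0.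
    by rewrite -[X in _ --> X](mulr0 C); apply: cvgM => //; exact: cvg_cst.
  apply: (@squeeze_cvgr _ _ _ _ (cst 0)
    (fun k => C * ts_norm V (s k t - phi t))) => //; last exact: cvg_cst.
  by apply: nearW => k; rewrite W0 -linearB TC.
(* [C] may be 0, whereas [integral_affine_lty] asks for a positive factor. *)
- have C1 : 0 < C ^+ 2 + 1 by rewrite ltr_wpDl ?sqr_ge0.
  refine (integral_affine_lty (mu := @lebesgue_measure R) _
    (itv_oo_lty a b) C1 (lexx 0) _ _ _ hi) => //.
  + by move=> x _; rewrite sqr_ge0.
  + by move=> x _; rewrite sqr_ge0.
  + move=> x _; rewrite addr0 mulrDl mul1r -exprMn ler_wpDr ?sqr_ge0//.
    by rewrite lerXn2r ?nnegrE ?W0// (le_trans (W0 _) (TC _)).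
Qed.

(** The bound is on the whole carrier because the approximating simple curves may leave
    [ts_mem V]. *)
Definition bounded_functional V (l : V -> R) := scalar l /\
  exists C, forall x, `|l x| <= C * ts_norm V x.

(** Naturality pushes both interpolates to the value space [R_space], where the two scalar curves
    agree almost everywhere. The seminorm there is the absolute value, so the conclusion is a true
    equality. *)
Lemma interpolator_functional (CV : tspace R -> Prop) (a b : R) I V W
    (phi : R -> V) (psi : R -> W) (l : V -> R) (m : W -> R) :
  CV (R_space R) -> CV V -> CV W -> time_interpolator CV a b I ->
  L2t a b phi -> L2t a b psi -> bounded_functional l -> bounded_functional m ->
  ae_on a b (fun t => l (phi t) = m (psi t)) -> l (I V phi) = m (I W psi).
Proof.
move=> CVR CVV CVW [_ _ Iae Inat] hphi hpsi [ll [C lC]] [ml [D mD]] lm.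
pose S : {linear V -> R_space R} :=
  HB.pack (l : V -> R_space R) (GRing.isLinear.Build R V (R_space R) *:%R l ll).
pose T : {linear W -> R_space R} :=
  HB.pack (m : W -> R_space R) (GRing.isLinear.Build R W (R_space R) *:%R m ml).
have bS : bounded_linear S by split => //; exists C => x _; exact: lC.
have bT : bounded_linear T by split => //; exists D => x _; exact: mD.
have ae0 : ae_on a b (fun t => ts_norm (R_space R) (S (phi t) - T (psi t)) = 0).
  apply: (ae_on_sub (lexx _) (lexx _) _ lm) => t _ {}lm.
  by rewrite /= lm subrr normr0.
have hS : L2t a b (V := R_space R) (fun t => S (phi t)).
  by refine (L2t_linear (W := R_space R) (T := S) _ _ lC hphi) => // x; exact: normr_ge0.
have hT : L2t a b (V := R_space R) (fun t => T (psi t)).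
  by refine (L2t_linear (W := R_space R) (T := T) _ _ mD hpsi) => // x; exact: normr_ge0.
have /normr0_eq0/subr0_eq e1 := Iae _ _ _ CVR hS hT ae0.
have /normr0_eq0/subr0_eq e2 := Inat _ _ S _ CVV CVR bS hphi.
have /normr0_eq0/subr0_eq e3 := Inat _ _ T _ CVW CVR bT hpsi.
exact: (etrans e2 (etrans e1 (esym e3))).
Qed.

End bochner.

(** * Norm bounds and square integrable curves in L^2, H^1 and the graph space of div (K grad) *)

Section spaces.
Context (R : realType) (d : nat) (Om : set 'rV[R]_d) (hOm : polyhedral_domain Om).
Local Notation mu := (vol hOm).

Lemma L2norm_ge0 f : 0 <= L2norm hOm f.
Proof. by rewrite fine_ge0// Lnorm_ge0. Qed.

Lemma ip_bound (f g : L2 hOm) : `|ip hOm f g| <= L2norm hOm f * L2norm hOm g.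
Proof.
have ifg := sqint_ip (LfunP f) (LfunP g).
apply: (le_trans (le_normr_Rintegral measurableT ifg)).
rewrite -lee_fin EFinM /L2norm !finite_norm_fine /Rintegral.
rewrite fineK; last first.
  by apply: integrable_fin_num => //; exact: (integrable_norm ifg).
have := @hoelder _ _ _ mu f g 2 2.
rewrite Lnorm1; apply => //.
by rewrite [RHS]splitr !div1r.
Qed.

(** The right-hand side minus the left-hand side is |f - 2g|^2. *)
Lemma L2norm_triangle2 (f g : L2 hOm) :
  L2norm hOm f ^+ 2 <= 2 * L2norm hOm (f - g : L2 hOm) ^+ 2 + 2 * L2norm hOm g ^+ 2.
Proof.
rewrite (_ : (f - g : L2 hOm) = (-1 *: g + f) :> L2 hOm); last first.
  by rewrite scaleN1r addrC.
rewrite L2_linE.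
have := ip_ge0 hOm (fun x => - 2 * g x + f x).
have hf := LfunP f; have hg := LfunP g.
by rewrite !L2norm_sqr !ip_sqr_lin//; lra.
Qed.

Lemma H1norm_sqr (q : H1car d hOm) :
  H1norm q ^+ 2 = L2norm hOm q.1 ^+ 2 + \sum_i L2norm hOm (q.2 i) ^+ 2.
Proof.
by rewrite sqr_sqrtr// addr_ge0 ?sqr_ge0 ?sumr_ge0// => i _; rewrite sqr_ge0.
Qed.

Lemma H1norm_triangle2 (q q' : H1car d hOm) :
  H1norm q ^+ 2 <= 2 * H1norm (q - q') ^+ 2 + 2 * H1norm q' ^+ 2.
Proof.
rewrite !H1norm_sqr !mulrDr addrACA lerD//; first exact: L2norm_triangle2.
rewrite !mulr_sumr -big_split ler_sum// => i _.
rewrite (_ : (q - q').2 i = q.2 i - q'.2 i) ?L2norm_triangle2//.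
by rewrite !ffunE.
Qed.

Lemma C0_H1_bounded (tF : R) (p : R -> H1car d hOm) : C0_H1 tF p ->
  exists M, forall t, 0 <= t <= tF -> H1norm (p t) ^+ 2 <= M.
Proof.
move=> hp.
(* Compactness in near-covering form, with the filter at +oo on candidate bounds: near each t the
   bound 2 + 2 |p(t)|^2 and all larger ones work, by [H1norm_triangle2] at distance less than 1. *)
have := @segment_compact R 0 tF => /compact_near_coveringP.
move=> /(_ R +oo (fun M t => 0 <= t <= tF -> H1norm (p t) ^+ 2 <= M)).
case=> [t /= tin|M [_ hM]].
  have [_ /(_ 1 ltr01)[del del0 hdel]] : H1 hOm (p t) /\ _ := hp t tin.
  exists (ball t del, [set M | 2 * 1 + 2 * H1norm (p t) ^+ 2 <= M]) => /=.
    split; [exact: nbhsx_ballx|]; apply: nbhs_pinfty_ge; exact: num_real.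
  move=> -[s M] [/= sdel leM] s0; apply: le_trans leM.
  apply: (le_trans (H1norm_triangle2 (p s) (p t))); rewrite lerD2r ler_pM2l//.
  rewrite expr_le1// ?sqrtr_ge0// ltW// hdel//.
  by move: sdel; rewrite /ball/= distrC.
exists (M + 1) => t tin; apply: (hM (M + 1)) => //=.
by rewrite ltrDl.
Qed.

Lemma bounded_functional_ip (K : 'rV[R]_d -> 'M[R]_d) (g : L2 hOm) :
  bounded_functional (V := divKgrad_space hOm K) (fun q => - ip hOm q.2 g).
Proof.
split=> [a q q'|].
  rewrite (_ : (a *: q + q').2 = a *: q.2 + q'.2 :> L2 hOm)// L2_linE.
  by rewrite ip_linl ?LfunP// mulrN opprD.
exists (L2norm hOm g) => q; rewrite normrN (le_trans (ip_bound _ _))//.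
rewrite mulrC ler_wpM2l ?L2norm_ge0//=.
by rewrite -[leLHS]ger0_norm ?L2norm_ge0// -sqrtr_sqr ler_wsqrtr// lerDr sqr_ge0.
Qed.

Lemma bounded_functional_fin (P : vectType R) (l : P -> R) : scalar l ->
  bounded_functional (V := fin_space P) l.
Proof.
move=> ll; split=> //.
pose L : {linear P -> R^o} :=
  HB.pack (l : P -> R^o) (GRing.isLinear.Build R P R^o *:%R l ll).
exists (\sum_(i < \dim {:P}) `|l (vbasis fullv)`_i|) => x.
rewrite [in leLHS](coord_vbasis (memvf x)).
rewrite (_ : l _ = \sum_(i < \dim {:P})
    coord (vbasis fullv) i x * l (vbasis fullv)`_i); last first.
  rewrite -[LHS]/(L _) linear_sum/=; apply: eq_bigr => i _.
  have l0 : l 0 = 0 by exact: (linear0 L).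
  by rewrite -[X in l X]addr0 ll l0 addr0.
apply: (le_trans (ler_norm_sum _ _ _)).
rewrite mulr_suml ler_sum// => i _; rewrite normrM mulrC ler_wpM2l//=.
by rewrite (bigD1 i)//= lerDl sumr_ge0.
Qed.

(** The sets of a simple curve need not be disjoint, so the two lists are concatenated and the
    values padded with 0. *)
Lemma simple_curve_pair (K : 'rV[R]_d -> 'M[R]_d)
  (s : R -> H1_space hOm) (s' : R -> L2_space hOm) :
  simple_curve s -> simple_curve s' ->
  simple_curve (V := divKgrad_space hOm K) (fun t => (s t, s' t)).
Proof.
move=> [n [A [v [mA sE]]]] [m [B [w [mB sE']]]].
exists (n + m)%N, (fun i => match fintype.split i with inl j => A j | inr k => B k end),
  (fun i => match fintype.split i with inl j => (v j, 0) | inr k => (0, w k) end).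
split=> [i|t]; first by case: fintype.split.
have sl i : fintype.split (lshift m i : 'I_(n + m)) = inl i := unsplitK (inl i).
have sr i : fintype.split (rshift n i : 'I_(n + m)) = inr i := unsplitK (inr i).
rewrite big_split_ord/= sE sE'.
under [X in _ = X + _]eq_bigr => i _ do rewrite sl.
under [X in _ = _ + X]eq_bigr => i _ do rewrite sr.
transitivity ((\sum_i (\1_(A i) t : R) *: v i, 0) +
  (0, \sum_i (\1_(B i) t : R) *: w i) : H1car d hOm * L2 hOm).
  by congr pair; rewrite /= ?addr0 ?add0r.
congr (_ + _).
  elim/big_rec2 : _ => // i x y _ <-.
  by congr pair; rewrite /= scaler0 add0r.
elim/big_rec2 : _ => // i x y _ <-.
by congr pair; rewrite /= scaler0 add0r.
Qed.

(* Continuity of p in time bounds the H^1 part of the graph norm by a constant;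
   measurability of t |-> |p(t)| is thus never needed. *)
Lemma L2t_divKgrad (K : 'rV[R]_d -> 'M[R]_d) (tF : R) (p : R -> H1car d hOm)
  (q : R -> L2 hOm) : C0_H1 tF p ->
  L2t 0 tF (V := H1_space hOm) p -> L2t 0 tF (V := L2_space hOm) q ->
  ae_on 0 tF (fun t => divKgrad_graph hOm K (p t, q t)) ->
  L2t 0 tF (V := divKgrad_space hOm K) (fun t => (p t, q t)).
Proof.
move=> hp [_ [s ss sp] _] [_ [s' ss' sq] qi] hK; split => //.
- exists (fun k t => (s k t, s' k t)).
    by move=> k; exact: simple_curve_pair.
  apply: (ae_on_sub (lexx _) (lexx _) _ (ae_onI sp sq)) => t _ [{}sp {}sq].
  apply: (@squeeze_cvgr _ _ _ _ (cst 0) (fun k =>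
    ts_norm (H1_space hOm) (s k t - p t) + ts_norm (L2_space hOm) (s' k t - q t))).
  + apply: nearW => k /=; rewrite sqrtr_ge0/= -[leRHS]ger0_norm; last first.
      by rewrite addr_ge0 ?sqrtr_ge0 ?L2norm_ge0.
    rewrite -sqrtr_sqr ler_wsqrtr// sqrrD lerD2r lerDl.
    by rewrite mulrn_wge0// mulr_ge0 ?sqrtr_ge0 ?L2norm_ge0.
  + exact: cvg_cst.
  + by rewrite -[X in _ --> X](addr0 0); exact: cvgD.
- have [M hM] := C0_H1_bounded hp.
  refine (integral_affine_lty (mu := @lebesgue_measure R) (M := `|M|) _
    (itv_oo_lty 0 tF) ltr01 _ _ _ _ qi) => //.
  + by move=> x _; rewrite sqr_ge0.
  + by move=> x _; rewrite sqr_ge0.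
  + move=> t /=; rewrite in_itv/= => /andP[t0 t1].
    rewrite sqr_sqrtr ?addr_ge0 ?sqr_ge0// mul1r addrC lerD2l.
    by rewrite (le_trans (hM t _))// ?ler_norm// !ltW.
Qed.

End spaces.

(** * The error estimate *)

(** Scalar bookkeeping for one time step: e, D and S stand for the norms of the displacement error,
    of the mean-free pressure error and of the momentum residual. The energy inequality is
    multiplied by 4. Of 4 al e^2, one part absorbs S e by Young, two pay for the squared inf-sup
    bound, one stays. Of 4 C0 Q, two absorb the mean part of W, one stays and one is dropped. *)
Lemma energy_step (R : realType) (al au bet C0 e D S Q A cz W V T : R) :
  0 < al -> 0 < au -> 0 < bet -> 0 <= C0 * Q -> 0 <= D ->
  bet * D <= S + au * e -> al * e ^+ 2 <= A ->
  A + C0 * Q + cz <= S * e + W ->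
  4 * W <= bet ^+ 2 * al / (2 * au ^+ 2) * D ^+ 2 + V + 2 * (C0 * Q) + T ->
  al * e ^+ 2 + (C0 * Q + bet ^+ 2 * al / (2 * au ^+ 2) * D ^+ 2) + 4 * cz
  <= (4 * au ^+ 2 + 2 * al ^+ 2) / (al * au ^+ 2) * S ^+ 2 + V + T.
Proof.
move=> al0 au0 bet0 CQ D0 bD eA AW W4.
have h1 : 2 * (bet ^+ 2 * al / (2 * au ^+ 2) * D ^+ 2) <=
    2 * al / au ^+ 2 * S ^+ 2 + 2 * al * e ^+ 2.
  have : (bet * D) ^+ 2 <= (S + au * e) ^+ 2.
    have bD0 : 0 <= bet * D by rewrite mulr_ge0// ltW.
    by rewrite lerXn2r ?nnegrE// (le_trans bD0).
  move=> h.
  have h' : al / au ^+ 2 * (bet * D) ^+ 2 <=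
      al / au ^+ 2 * (2 * S ^+ 2 + 2 * (au * e) ^+ 2).
    rewrite ler_pM2l ?divr_gt0 ?exprn_gt0// (le_trans h)//.
    have := sqr_ge0 (S - au * e); nra.
  rewrite (_ : 2 * _ = al / au ^+ 2 * (bet * D) ^+ 2); last by field; rewrite gt_eqF.
  rewrite (le_trans h')// le_eqVlt; apply/orP; left; apply/eqP.
  by field; rewrite gt_eqF.
have h2 : 4 * (S * e) <= al * e ^+ 2 + 4 / al * S ^+ 2.
  have : 0 <= al * (e - 2 / al * S) ^+ 2 by rewrite mulr_ge0 ?sqr_ge0// ltW.
  rewrite (_ : al * (e - _) ^+ 2 =
    al * e ^+ 2 + 4 / al * S ^+ 2 - 4 * (S * e)) ?subr_ge0//.
  by field; rewrite gt_eqF.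
have -> : (4 * au ^+ 2 + 2 * al ^+ 2) / (al * au ^+ 2) * S ^+ 2 =
    4 / al * S ^+ 2 + 2 * al / au ^+ 2 * S ^+ 2.
  by field; rewrite !gt_eqF.
lra.
Qed.

Unset Implicit Arguments.

Theorem lemma10 (R : realType) (d : nat) (hd : d = 2%N \/ d = 3%N)
  (Om : set 'rV[R]_d) (hOm : polyhedral_domain Om)
  (tF : R) (htF : 0 < tF) (C0 : R) (hC0 : 0 <= C0)
  (K : 'rV[R]_d -> 'M[R]_d) (hK : tensor_field Om K)
  (* time steps *)
  (N : nat) (hN : (1 <= N)%N)
  (tau : R) (htau : tau = tF / N%:R)
  (tn : nat -> R) (htn : forall n, tn n = n%:R * tau)
  (* discrete spaces and forms *)
  (Uh Ph : vectType R)
  (r : Ph -> L2 hOm) (hr : linear_ae r)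
  (a : {bilinear Uh -> Uh -> R | *%R & *%R})
  (b : {bilinear Uh -> Ph -> R | *%R & *%R})
  (c : {bilinear Ph -> Ph -> R | *%R & *%R})
  (hc : forall q q', c q q' = c q' q)
  (hb : factors_through r b)
  (* discrete data *)
  (f : nat -> {scalar Uh}) (g : nat -> L2 hOm) (phi0 : L2 hOm)
  (hdata : C0 = 0 -> intO hOm phi0 = 0 /\
     forall n, (1 <= n <= N)%N -> intO hOm (g n) = 0)
  (* stability *)
  (normU : Uh -> R) (hnormU : is_norm normU)
  (normP : Ph -> R) (hnormP : is_seminorm normP)
  (hnormP0 : forall q, intO hOm (r q) = 0 -> normP q = 0 -> q = 0)
  (al au gam bet : R)
  (hal : 0 < al) (halau : al <= au) (hgam : 0 < gam) (hbet : 0 < bet)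
  (ha_coer : forall v, al * normU v ^+ 2 <= a v v)
  (ha_bnd : forall w v, a w v <= au * normU w * normU v)
  (hc_coer : forall q, gam * normP q ^+ 2 <= c q q)
  (hinfsup : forall q,
     bet * L2norm hOm (fun x => r q x - mean hOm (r q))
     <= dual_norm normU (fun v => b v q))
  (* exact solution of the Biot problem *)
  (sigma : {linear 'M[R]_d -> 'M[R]_d})
  (hsigma : forall s : 'M[R]_d, s^T = s -> (sigma s)^T = sigma s)
  (fex : R -> 'I_d -> L2 hOm) (gex : R -> L2 hOm) (phi0ex : L2 hOm)
  (uex : R -> 'I_d -> H1car d hOm) (pex : R -> H1car d hOm)
  (hbiot : biot_weak_solution tF C0 K sigma fex gex phi0ex uex pex)
  (hpex : C0_H1 tF pex)
  (divKp : R -> L2 hOm) (hdivKp : L2t 0 tF (V := L2_space hOm) divKp)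
  (hdivKpE : ae_on 0 tF (fun t => divKgrad_graph hOm K (pex t, divKp t)))
  (* interpolates *)
  (uhat : nat -> Uh)
  (pfr : R -> Ph) (hpfr : L2t 0 tF (V := fin_space Ph) pfr)
  (hpfrE : ae_on 0 tF (fun t =>
     (forall q, c (pfr t) q = - ip hOm (divKp t) (r q)) /\
     intO hOm (r (pfr t)) = intO hOm (pex t).1))
  (CV : tspace R -> Prop) (hCVR : CV (R_space R))
  (hCVP : CV (fin_space Ph)) (hCVD : CV (divKgrad_space hOm K))
  (I : nat -> forall V : tspace R, (R -> V) -> V)
  (hI : forall n, (1 <= n <= N)%N ->
     time_interpolator CV (tn n.-1) (tn n) (I n))
  (phat : nat -> Ph)
  (hphat : forall n, (1 <= n <= N)%N -> phat n = I n (fin_space Ph) pfr)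
  (hphat0 : forall q, Lh r q ->
     ip hOm (r (phat 0%N)) q = ip hOm (pex 0).1 q)
  (Ip : nat -> H1car d hOm * L2 hOm)
  (hIp : forall n, (1 <= n <= N)%N ->
     Ip n = I n (divKgrad_space hOm K) (fun t => (pex t, divKp t)))
  (* discrete solution *)
  (u : nat -> Uh) (p : nat -> Ph)
  (hD1 : forall n, (1 <= n <= N)%N -> forall v,
     a (u n) v + b v (p n) = f n v)
  (hD2 : forall n, (1 <= n <= N)%N -> forall q,
     C0 * ip hOm (r (delta_t tau p n)) (r q) - b (delta_t tau u n) q
     + c (p n) q = ip hOm (g n) (r q))
  (hD3 : forall q,
     C0 * ip hOm (r (p 0%N)) (r q) - b (u 0%N) q = ip hOm phi0 (r q))
  (hD4 : C0 = 0 -> forall n, (1 <= n <= N)%N -> intO hOm (r (p n)) = 0)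
  (* errors *)
  (e : nat -> Uh) (he : forall n, (n <= N)%N -> e n = u n - uhat n)
  (ep : nat -> Ph) (hep : forall n, (n <= N)%N -> ep n = p n - phat n)
  (z : nat -> Ph) (hz0 : z 0%N = 0)
  (hz : forall n, (1 <= n <= N)%N -> z n = \sum_(1 <= i < n.+1) tau *: ep i)
  (* residuals *)
  (E0 : L2 hOm) (hE0L : Lh r E0)
  (hE0 : forall q, ip hOm E0 (r q) =
     ip hOm phi0 (r q) - C0 * ip hOm (r (phat 0%N)) (r q) + b (uhat 0%N) q)
  (EU : nat -> Uh -> R)
  (hEU : forall n, (1 <= n <= N)%N -> forall v,
     EU n v = f n v - a (uhat n) v - b v (phat n))
  (EP : nat -> L2 hOm) (hEPL : forall n, (1 <= n <= N)%N -> Lh r (EP n))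
  (hEP : forall n, (1 <= n <= N)%N -> forall q,
     ip hOm (EP n) (r q) = \sum_(1 <= i < n.+1) tau *
       (ip hOm (fun x => g i x + (Ip i).2 x) (r q)
        - C0 * ip hOm (r (delta_t tau phat i)) (r q)
        + b (delta_t tau uhat i) q))
  (* constants *)
  (C1 : R) (hC1 : C1 = (4 * au ^+ 2 + 2 * al ^+ 2) / (al * au ^+ 2))
  (C2 : R) (hC2 : C2 = 16 * au ^+ 2 / (al * bet ^+ 2)) :
  al * (\sum_(1 <= n < N.+1) tau * normU (e n) ^+ 2)
  + \sum_(1 <= n < N.+1) tau *
      (C0 * L2norm hOm (r (ep n)) ^+ 2
       + bet ^+ 2 * al / (2 * au ^+ 2)
         * L2norm hOm (fun x => r (ep n) x - mean hOm (r (ep n))) ^+ 2)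
  + gam * normP (z N) ^+ 2
  <= C1 * (\sum_(1 <= n < N.+1) tau * dual_norm normU (EU n) ^+ 2)
     + C2 * (\sum_(1 <= n < N.+1) tau * L2norm hOm (EP n) ^+ 2
             + tF * L2norm hOm E0 ^+ 2)
     + (if C0 == 0 then 0 else
        4 / C0 *
          (\sum_(1 <= n < N.+1) tau * L2norm hOm (cst (mean hOm (EP n))) ^+ 2
           + tF * L2norm hOm (cst (mean hOm E0)) ^+ 2)).
Proof.
have N0 : N%:R != 0 :> R by rewrite pnatr_eq0 -lt0n.
have tau0 : 0 < tau by rewrite htau divr_gt0// ltr0n.
have Ntau : N%:R * tau = tF by rewrite htau mulrCA divff ?mulr1.
have au0 : 0 < au := lt_le_trans hal halau.
(* [r] is linear only almost everywhere, so its linearity is used under inner products. *)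
have rL (k : R) q q' h : h \in Lfun (vol hOm) 2%:E ->
    ip hOm (r (k *: q + q')) h = k * ip hOm (r q) h + ip hOm (r q') h.
  move=> hh.
  rewrite (ip_aeql (LfunP _) (LfunP (k *: r q + r q' : L2 hOm)) hh (hr k q q')).
  by rewrite L2_linE; apply: ip_linl => //; exact: LfunP.
have rB q q' h : h \in Lfun (vol hOm) 2%:E ->
    ip hOm (r (q - q')) h = ip hOm (r q) h - ip hOm (r q') h.
  by move=> hh; rewrite addrC -scaleN1r rL// mulN1r addrC.
have rdelta x n h : h \in Lfun (vol hOm) 2%:E ->
    ip hOm (r (delta_t tau x n)) h =
      tau^-1 * (ip hOm (r (x n)) h - ip hOm (r (x n.-1)) h).
  move=> hh; have r0 : ip hOm (r 0) h = 0 by have := rB 0 0 h hh; rewrite subr0 subrr.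
  by rewrite /delta_t -[_ *: _]addr0 rL// r0 addr0 rB.
have bdelta x n q : b (delta_t tau x n) q = tau^-1 * (b (x n) q - b (x n.-1) q).
  by rewrite /delta_t linearZl_LR linearBl.
have tn_sub n : (1 <= n <= N)%N -> 0 <= tn n.-1 /\ tn n <= tF.
  move=> /andP[n1 nN]; rewrite !htn; split; first by rewrite mulr_ge0// ltW.
  by rewrite -Ntau ler_pM2r// ler_nat.
have hpexL2 : L2t 0 tF (V := H1_space hOm) pex by case: hbiot => -[].
have hdiv := L2t_divKgrad hpex hpexL2 hdivKp hdivKpE.
(* The pair of p and its flux divergence is interpolated as one element of the graph space, so
   [(Ip n).2] is div (K grad) of the interpolate of p. *)
have cphat n q : (1 <= n <= N)%N -> c (phat n) q = - ip hOm (Ip n).2 (r q).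
  move=> hn; rewrite hphat// hIp//; have [t0 tT] := tn_sub n hn.
  apply: (interpolator_functional (V := fin_space Ph) (W := divKgrad_space hOm K)
    (l := fun x => c x q) (m := fun x => - ip hOm x.2 (r q)) hCVR hCVP hCVD (hI n hn)).
  - exact: L2t_sub t0 tT hpfr.
  - exact: L2t_sub t0 tT hdiv.
  - by apply: bounded_functional_fin => k x y; rewrite linearPl.
  - exact: bounded_functional_ip.
  - by apply: (ae_on_sub t0 tT _ hpfrE) => t _ [h _]; exact: h.
have intr_lin : scalar (fun q => intO hOm (r q)).
  by move=> k x y; rewrite !intO_ip rL// sqint_cst.
have phat_mean n : C0 = 0 -> (1 <= n <= N)%N -> intO hOm (r (phat n)) = 0.
  move=> C00 hn; rewrite hphat//; have [t0 tT] := tn_sub n hn.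
  have hp := L2t_sub t0 tT hpfr.
  (* The mean of [pfr] is compared with the zero functional on the same curve. *)
  apply: (interpolator_functional (V := fin_space Ph) (W := fin_space Ph)
    (l := fun q => intO hOm (r q)) (m := fun _ => 0) hCVR hCVP hCVP (hI n hn) hp hp).
  - exact: bounded_functional_fin.
  - by apply: bounded_functional_fin => k x y; rewrite mulr0 addr0.
  - apply: (ae_on_sub t0 tT _ hpfrE) => t /andP[t1 t2] [_ ->].
    by have [_ _ _ h] := hbiot; apply: (h C00); rewrite !ltW.
have zE n : (n <= N)%N -> z n = \sum_(1 <= i < n.+1) tau *: ep i.
  by case: n => [_|n nN]; [rewrite hz0 big_geq|rewrite hz].
have E1 n v : (1 <= n <= N)%N -> EU n v = a (e n) v + b v (ep n).
  move=> hn; have [_ nN] := andP hn; rewrite hEU// -hD1// he// hep// linearBl linearBr/=.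
  ring.
have G0 q : C0 * ip hOm (r (ep 0%N)) (r q) - b (e 0%N) q = ip hOm E0 (r q).
  rewrite he// hep// rB ?LfunP// linearBl hE0 -hD3; ring.
have E2 n q : (n <= N)%N -> (1 <= n)%N ->
    C0 * ip hOm (r (ep n)) (r q) - b (e n) q + c (z n) q =
    ip hOm E0 (r q) + ip hOm (EP n) (r q).
  move=> nN n1; rewrite hEP ?n1// -G0 zE//.
  (* [EP] is only given for n >= 1, but once it is replaced by its sum the identity makes sense at n
     = 0, where it is [G0]. *)
  elim: n nN {n1} => [|n IH] nN; first by rewrite !big_geq// linear0l/= !addr0.
  rewrite !(@big_nat_recr _ _ _ n.+1 1)//= linearDl/= linearZl_LR/=.
  rewrite [RHS]addrA -IH ?(ltnW nN)//.
  have := hD2 n.+1 nN q; rewrite !rdelta ?LfunP// !bdelta/=.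
  rewrite (he _ nN) (he _ (ltnW nN)) (hep _ nN) (hep _ (ltnW nN)).
  rewrite !rB ?LfunP// !linearBl/= cphat//.
  have -> : ip hOm (fun x => g n.+1 x + (Ip n.+1).2 x) (r q) =
      ip hOm (g n.+1) (r q) + ip hOm (Ip n.+1).2 (r q).
    rewrite -[ip _ (g _) _]mul1r -ip_linl ?LfunP//.
    by congr (ip hOm _ _); apply/funext => x; rewrite mul1r.
  move=> <-; field; exact: lt0r_neq0.
have c_ge0 q : 0 <= c q q.
  by apply: le_trans (hc_coer q); rewrite mulr_ge0 ?sqr_ge0// ltW.
have cz : gam * normP (z N) ^+ 2 <= \sum_(1 <= n < N.+1) tau * (4 * c (z n) (ep n)).
  (* Each step leaves the remainder 2 tau^2 c(ep, ep) >= 0. The factor 4 matches [energy_step]; the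
     resulting 2 c(z, z) is more than the claim asks for. *)
  have h n : (n <= N)%N ->
      2 * c (z n) (z n) <= \sum_(1 <= i < n.+1) tau * (4 * c (z i) (ep i)).
    elim: n => [_|n IH nN]; first by rewrite hz0 linear0l big_geq// mulr0.
    rewrite big_nat_recr//=; have := IH (ltnW nN).
    have -> : z n.+1 = z n + tau *: ep n.+1.
      by rewrite !zE// ?(ltnW nN)// big_nat_recr.
    have cl x y : c (x + tau *: y) y = c x y + tau * c y y.
      by rewrite addrC linearPl addrC.
    have cq x y : c (x + tau *: y) (x + tau *: y) =
        c x x + 2 * tau * c x y + tau ^+ 2 * c y y.
      by rewrite addrC linearPl/= !(linearPr c)/= (hc y x); ring.
    rewrite cq cl => H.
    have : 0 <= tau ^+ 2 * c (ep n.+1) (ep n.+1) by rewrite mulr_ge0 ?sqr_ge0.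
    lra.
  have := h N (leqnn N); have := hc_coer (z N); have := c_ge0 (z N); lra.
set kap := bet ^+ 2 * al / (2 * au ^+ 2).
have kap0 : 0 < kap by rewrite divr_gt0 ?mulr_gt0 ?exprn_gt0.
have [[normU0 _ normUZ] normU_eq0] := hnormU.
have normUN v : normU (- v) = normU v by rewrite -scaleN1r normUZ normrN1 mul1r.
(* The share of one time step in the mean-value term, with the convention for [C0 = 0] built in. *)
pose T n := if C0 == 0 then 0 else
  4 / C0 * (L2norm hOm (cst (mean hOm (EP n))) ^+ 2
            + L2norm hOm (cst (mean hOm E0)) ^+ 2).
have step n : (1 <= n <= N)%N ->
    al * normU (e n) ^+ 2 + (C0 * L2norm hOm (r (ep n)) ^+ 2
    + kap * L2norm hOm (fun x => r (ep n) x - mean hOm (r (ep n))) ^+ 2)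
    + 4 * c (z n) (ep n) <=
    C1 * dual_norm normU (EU n) ^+ 2
    + C2 * (L2norm hOm (EP n) ^+ 2 + L2norm hOm E0 ^+ 2) + T n.
  move=> hn; have [n1 nN] := andP hn; rewrite hC1.
  have EUl : scalar (EU n).
    by move=> k x y; rewrite !E1// linearPr linearPl/=; ring.
  have EU0 : EU n 0 = 0 by rewrite E1// linear0r linear0l addr0.
  have EUN v : EU n (- v) = - EU n v.
    by rewrite !E1// linearNr linearNl/= opprD.
  have a0 v : a v v = 0 -> v = 0.
    move=> av0; apply/normU_eq0/eqP; rewrite -sqrf_eq0 eq_le sqr_ge0 andbT.
    by rewrite -(pmulr_rle0 _ hal) -av0.
  have [w wE] := riesz_coercive EUl a0.
  have EUb v : EU n v <= au * normU w * normU v by rewrite -wE.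
  have EUd := dual_norm_ub hnormU EU0 EUb.
  have EUd0 := dual_norm_ge0 hnormU EUN EUb.
  apply: (energy_step (A := a (e n) (e n))
    (W := ip hOm E0 (r (ep n)) + ip hOm (EP n) (r (ep n)))) => //.
  - by rewrite mulr_ge0 ?sqr_ge0.
  - exact: L2norm_ge0.
  - apply: le_trans (hinfsup (ep n)) _; apply: dual_norm_le => // [|v].
      by rewrite addr_ge0// mulr_ge0// ltW.
    (* [ha_bnd] bounds [a] from above only, so the minus sign is moved into its argument. *)
    have -> : b v (ep n) = EU n v + a (- e n) v by rewrite E1// linearNl; ring.
    rewrite mulrDl lerD ?EUd// -(normUN (e n)); exact: ha_bnd.
  - have := E2 n (ep n) nN n1; rewrite L2norm_sqr => <-.
    have := EUd (e n); rewrite E1//; lra.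
  - have := residual_young kap0 (LfunP (EP n)) (LfunP E0) (LfunP (r (ep n))).
    rewrite (addrC (ip hOm E0 _)) => /le_trans; apply.
    have -> : C2 = 8 / kap by rewrite hC2 /kap; field; rewrite !gt_eqF.
    rewrite -/kap -[leRHS]addrA lerD2l /T; case: eqP => [C00|/eqP C00].
      (* For [C0 = 0] the mean is moved back onto the pressure error, whose mean vanishes by [hD4]
         and [phat_mean]. *)
      rewrite -!ip_mean ?LfunP//.
      have -> : mean hOm (r (ep n)) = 0.
        rewrite /mean hep// intO_ip rB ?sqint_cst// -!intO_ip hD4// phat_mean//.
        by rewrite subrr mulr0.
      by rewrite ![ip _ _ (cst 0)]ipC !ip_cst ?LfunP// !mul0r C00; lra.
    have C0p : 0 < C0 by rewrite lt_neqAle eq_sym C00.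
    (* Young with weight [C0] for each of the two residuals uses up exactly the 2 C0 |r ep|^2
       allowed by [energy_step]. *)
    have h1 := ip_young C0p (sqint_cst hOm (mean hOm (EP n))) (LfunP (r (ep n))).
    have h2 := ip_young C0p (sqint_cst hOm (mean hOm E0)) (LfunP (r (ep n))).
    lra.
(* The initial residual enters every step; since N tau = tF, its copies add up to the factor
   [tF]. *)
have sum_const (k y : R) (F : nat -> R) :
    \sum_(1 <= n < N.+1) tau * (k * (F n + y)) =
    k * (\sum_(1 <= n < N.+1) tau * F n + tF * y).
  have -> : tF * y = \sum_(1 <= n < N.+1) tau * y.
    by rewrite sumr_const_nat subSS subn0 -mulr_natl mulrA Ntau.
  rewrite -big_split mulr_sumr; apply: eq_bigr => n _ /=; ring.
have -> : (if C0 == 0 then 0 else 4 / C0 *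
    (\sum_(1 <= n < N.+1) tau * L2norm hOm (cst (mean hOm (EP n))) ^+ 2
     + tF * L2norm hOm (cst (mean hOm E0)) ^+ 2)) = \sum_(1 <= n < N.+1) tau * T n.
  by rewrite /T; case: eqP => _; [rewrite big1// => n _; rewrite mulr0|rewrite sum_const].
rewrite -sum_const !mulr_sumr -!big_split/=; apply: le_trans (lerD (lexx _) cz) _.
rewrite -big_split/=; apply: ler_sum_nat => n; rewrite ltnS => hn.
have := ler_wpM2l (ltW tau0) (step n hn); lra.
Qed.
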